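(* Let $a,b,q\in\mathbb{C}$ with $|q|<1$ and $|qb/a|<1$. Then $$\frac{(a^2q,b^2q;q^4)_\infty}{(a^2q^3,b^2q^3;q^4)_\infty}=\cfrac{(1-a^2q)(1-b^2q)}{1-abq^2+\cfrac{(a-bq)(b-aq)q^2}{1-abq^4+\cfrac{(1-a^2q^3)(1-b^2q^3)q^2}{1-abq^6+\cfrac{(a-bq^3)(b-aq^3)q^4}{1-abq^8+\cdots}}}},$$ i.e. the left side equals $K_{k\ge1}(a_k/b_k)$ with $b_k=1-abq^{2k}$ for $k\ge1$, and $a_{2n-1}=(1-a^2q^{2n-1})(1-b^2q^{2n-1})q^{2n-2}$, $a_{2n}=(a-bq^{2n-1})(b-aq^{2n-1})q^{2n}$ for $n\ge1$.
   Context: $(x;q)_\infty=\prod_{n\ge0}(1-xq^n)$ and $(x,y;q)_\infty=(x;q)_\infty(y;q)_\infty$. For complex sequences $(a_k)_{k\ge1}$ with all $a_k\neq0$ and $(b_k)_{k\ge1}$, the continued fraction $K_{k\ge1}(a_k/b_k)=\cfrac{a_1}{b_1+\cfrac{a_2}{b_2+\cdots}}$ has value $f\in\mathbb{C}\cup\{\infty\}$ if its approximants $\cfrac{a_1}{b_1+\cdots+\cfrac{a_n}{b_n}}$ converge to $f$ as $n\to\infty$. The parameters are assumed to be such that both sides make sense: $a\neq0$, the product in the denominator on the left is nonzero, and all partial numerators $a_k$ are nonzero. *)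

(* Defs.v *)
(* Stdlib reals with Coquelicot: the complex numbers are Coquelicot's [C]. *)
From Stdlib Require Import Reals Arith Lia.
From Coquelicot Require Import Coquelicot.

Open Scope C_scope.

Fixpoint qpoch_fin (x q : C) (N : nat) : C :=
  match N with
  | O => 1
  | S n => qpoch_fin x q n * (1 - x * q ^ n)
  end.

(* [iota] picks the unique point satisfying a predicate; the partial products
   converge whenever |q| < 1. *)
Definition qpoch (x q : C) : C :=
  @iota C_CompleteNormedModule
    (fun l : C => filterlim (qpoch_fin x q) eventually (locally l)).

Definition qpoch2 (x y q : C) : C := qpoch x q * qpoch y q.

Inductive Csphere : Type :=
  | Cfin (z : C)
  | Cinf.

Definition locally_sphere (f : Csphere) (P : Csphere -> Prop) : Prop :=
  match f with
  | Cfin z => locally z (fun w : C => P (Cfin w))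
  | Cinf => P Cinf /\ exists M : R, forall w : C, (M < Cmod w)%R -> P (Cfin w)
  end.

(* The map t |-> a / (b + t) of the Riemann sphere; sending -b to infinity is
   the right convention only for a <> 0. *)
Definition cf_step (a b : C) (t : Csphere) : Csphere :=
  match t with
  | Cinf => Cfin 0
  | Cfin t => if Ceq_dec (b + t) 0 then Cinf else Cfin (a / (b + t))
  end.

(* a_k / (b_k + a_{k+1} / (b_{k+1} + ... + a_{k+n-1} / b_{k+n-1})), with
   intermediate values allowed to be infinite. *)
Fixpoint cf_from (a b : nat -> C) (n k : nat) : Csphere :=
  match n with
  | O => Cfin 0
  | S m => cf_step (a k) (b k) (cf_from a b m (S k))
  end.

Definition cf_approximant (a b : nat -> C) (n : nat) : Csphere :=
  cf_from a b n 1.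

(* The values [a 0] and [b 0] play no role. *)
Definition is_cf_value (a b : nat -> C) (f : Csphere) : Prop :=
  filterlim (cf_approximant a b) eventually (locally_sphere f).

Definition cf_den (a b q : C) (k : nat) : C := 1 - a * b * q ^ (2 * k).

(* For k = 2n - 1 and for k = 2n, [Nat.div2 (S k)] is n. *)
Definition cf_num (a b q : C) (k : nat) : C :=
  let n := Nat.div2 (S k) in
  if Nat.odd k then
    (1 - a ^ 2 * q ^ (2 * n - 1)) * (1 - b ^ 2 * q ^ (2 * n - 1))
      * q ^ (2 * n - 2)
  else
    (a - b * q ^ (2 * n - 1)) * (b - a * q ^ (2 * n - 1)) * q ^ (2 * n).

Lemma cf_num_odd (a b q : C) (n : nat) : (1 <= n)%nat ->
  cf_num a b q (2 * n - 1) =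
  (1 - a ^ 2 * q ^ (2 * n - 1)) * (1 - b ^ 2 * q ^ (2 * n - 1))
    * q ^ (2 * n - 2).
Proof.
intros Hn; unfold cf_num.
replace (S (2 * n - 1)) with (2 * n)%nat by lia.
rewrite Nat.div2_double.
replace (2 * n - 1)%nat with (2 * (n - 1) + 1)%nat by lia.
now rewrite Nat.odd_odd.
Qed.

Lemma cf_num_even (a b q : C) (n : nat) :
  cf_num a b q (2 * n) =
  (a - b * q ^ (2 * n - 1)) * (b - a * q ^ (2 * n - 1)) * q ^ (2 * n).
Proof.
unfold cf_num.
now rewrite Nat.div2_succ_double, Nat.odd_even.
Qed.

(* Main.v *)
(* The coefficients satisfy b_k -> 1 and a_k -> 0 geometrically, so the
   recurrence X_k = b_k X_{k+1} + a_{k+1} X_{k+2} has exactly one solution with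
   X_k -> 1, the limit of the backward continuants, and the continued fraction
   has the value a_1 X_2 / X_1. Write X_k(a,b) for it and put
   N_j = (1 - a^2 q^{2j+1})(1 - b^2 q^{2j+1}),
   n_j = (a - b q^{2j-1})(b - a q^{2j-1}). The identities
   N_j = q^2 n_j + b_1 b_{2j} = n_{j+1} + b_0 b_{2j+1} make the Bauer-Muir
   transform of the fraction for (a,b) the fraction for (aq,bq). On solutions,
   with Y_k = X_k(aq,bq), this reads
     X_{2j} = Y_{2j-1},   X_{2j+1} = Y_{2j} - b_1 q^{2j} Y_{2j+1},
   and gives X_2(a,b) = X_1(aq,bq) and
   X_1(a,b) = (1 - a^2 q^3)(1 - b^2 q^3) X_1(aq^2,bq^2). Iterating,
   X_1(a,b) = (a^2 q^3, b^2 q^3; q^4)_oo X_1(0,0), with X_1(0,0) <> 0. *)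
Require Import Defs.
From Stdlib Require Import Reals Lra Lia.
From Coquelicot Require Import Coquelicot.

Open Scope C_scope.

(** * Convergence of complex sequences *)

Lemma Im_le_Cmod (z : C) : (Rabs (Im z) <= Cmod z)%R.
Proof. eapply Rle_trans; [apply Rmax_r|apply Rmax_Cmod]. Qed.

(** Stated through the real sequence of moduli, so that limit lemmas for real sequences apply
    directly. *)
Definition Ccvg (u : nat -> C) (l : C) : Prop :=
  is_lim_seq (fun n => Cmod (u n - l)) 0.

Lemma Ccvg_of_le (u : nat -> C) (l : C) (v : nat -> R) :
  is_lim_seq v 0 -> (forall n, (Cmod (u n - l) <= v n)%R) -> Ccvg u l.
Proof.
intros Hv H. apply is_lim_seq_le_le with (fun _ => 0%R) v; auto.
- intros n; split; [apply Cmod_ge_0 | apply H].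
- apply is_lim_seq_const.
Qed.

Lemma Ccvg_ext_loc (u v : nat -> C) (l : C) :
  (exists N, forall n, (N <= n)%nat -> u n = v n) -> Ccvg u l -> Ccvg v l.
Proof.
intros [N E]; apply is_lim_seq_ext_loc; exists N; intros n Hn; now rewrite E.
Qed.

Lemma Ccvg_ext (u v : nat -> C) (l : C) :
  (forall n, u n = v n) -> Ccvg u l -> Ccvg v l.
Proof. intros E; apply Ccvg_ext_loc; now exists O. Qed.

Lemma Ccvg_const (c : C) : Ccvg (fun _ => c) c.
Proof.
apply is_lim_seq_ext with (fun _ => 0%R); [|apply is_lim_seq_const].
intros n; replace (c - c) with (RtoC 0) by ring; now rewrite Cmod_0.
Qed.

Lemma Ccvg_shift (u : nat -> C) (l : C) (m : nat) :
  Ccvg u l -> Ccvg (fun n => u (n + m)%nat) l.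
Proof. intros H; exact (proj1 (is_lim_seq_incr_n _ m _) H). Qed.

Lemma Ccvg_plus (u v : nat -> C) (l m : C) :
  Ccvg u l -> Ccvg v m -> Ccvg (fun n => u n + v n) (l + m).
Proof.
intros Hu Hv.
apply Ccvg_of_le with (fun n => Cmod (u n - l) + Cmod (v n - m))%R.
- replace (Finite 0) with (Finite (0 + 0)) by (f_equal; ring).
  now apply is_lim_seq_plus'.
- intros n; replace (u n + v n - (l + m)) with ((u n - l) + (v n - m)) by ring.
  apply Cmod_triangle.
Qed.

Lemma Ccvg_mult (u v : nat -> C) (l m : C) :
  Ccvg u l -> Ccvg v m -> Ccvg (fun n => u n * v n) (l * m).
Proof.
intros Hu Hv.
apply Ccvg_of_le with
  (fun n => Cmod (u n - l) * Cmod (v n - m)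
            + Cmod (u n - l) * Cmod m + Cmod l * Cmod (v n - m))%R.
- replace (Finite 0) with (Finite (0 * 0 + 0 * Cmod m + Cmod l * 0))
    by (f_equal; ring).
  repeat apply is_lim_seq_plus'; apply is_lim_seq_mult'; auto;
    apply is_lim_seq_const.
- intros n.
  replace (u n * v n - l * m)
    with ((u n - l) * (v n - m) + (u n - l) * m + l * (v n - m)) by ring.
  rewrite <- !Cmod_mult.
  eapply Rle_trans; [apply Cmod_triangle|].
  apply Rplus_le_compat_r, Cmod_triangle.
Qed.

Lemma Ccvg_unique (u : nat -> C) (l m : C) : Ccvg u l -> Ccvg u m -> l = m.
Proof.
intros Hl Hm.
assert (H : (Cmod (l - m) <= 0)%R).
{ refine (is_lim_seq_le (fun _ => Cmod (l - m))
    (fun n => Cmod (u n - l) + Cmod (u n - m))%R (Cmod (l - m)) 0 _ _ _).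
  - intros n; rewrite <- (Cmod_opp (u n - l)).
    replace (l - m) with (- (u n - l) + (u n - m)) by ring.
    apply Cmod_triangle.
  - apply is_lim_seq_const.
  - replace (Finite 0) with (Finite (0 + 0)) by (f_equal; ring).
    now apply is_lim_seq_plus'. }
assert (E : l - m = 0).
{ apply Cmod_eq_0, Rle_antisym; [assumption|apply Cmod_ge_0]. }
replace l with ((l - m) + m) by ring; rewrite E; ring.
Qed.

Lemma Ccvg_eventually_lt (u : nat -> C) (l : C) (e : R) :
  (0 < e)%R -> Ccvg u l ->
  exists N, forall n, (N <= n)%nat -> (Cmod (u n - l) < e)%R.
Proof.
intros He H; apply is_lim_seq_spec in H.
destruct (H (mkposreal e He)) as [N HN]; exists N; intros n Hn.
specialize (HN n Hn); simpl in HN.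
rewrite Rminus_0_r, Rabs_pos_eq in HN; [exact HN|apply Cmod_ge_0].
Qed.

Lemma Ccvg_eventually_neq0 (u : nat -> C) (l : C) :
  l <> 0 -> Ccvg u l -> exists N, forall n, (N <= n)%nat -> u n <> 0.
Proof.
intros Hl H.
destruct (Ccvg_eventually_lt u l (Cmod l)) as [N HN]; auto.
{ now apply Cmod_gt_0. }
exists N; intros n Hn E; specialize (HN n Hn); rewrite E in HN.
replace (0 - l) with (- l) in HN by ring; rewrite Cmod_opp in HN; lra.
Qed.

(** Since the limit [m] is nonzero, [v n] can be inverted from some index on, where the error of the
    inverse is |v n - m| / (|v n| |m|). *)
Lemma Ccvg_div (u v : nat -> C) (l m : C) :
  m <> 0 -> Ccvg u l -> Ccvg v m -> Ccvg (fun n => u n / v n) (l / m).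
Proof.
intros Hm Hu Hvm.
assert (Hinv : Ccvg (fun n => / v n) (/ m)).
{ destruct (Ccvg_eventually_neq0 v m Hm Hvm) as [N Hv].
  apply is_lim_seq_ext_loc with
    (fun n => Cmod (v n - m) * / (Cmod (v n) * Cmod m))%R.
  - exists N; intros n Hn; specialize (Hv n Hn); rewrite <- Cmod_mult, <- Cmod_inv, <- Cmod_mult, <- Cmod_opp.
    + f_equal; field; now split.
    + apply Cmult_neq_0; auto.
  - assert (Hn : is_lim_seq (fun n => Cmod (v n)) (Cmod m)).
    { apply is_lim_seq_le_le with (fun n => Cmod m - Cmod (v n - m))%R
        (fun n => Cmod m + Cmod (v n - m))%R.
      - intros n; split.
        + pose proof (Cmod_triangle (- (v n - m)) (v n)) as H.
          rewrite Cmod_opp in H.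
          replace (- (v n - m) + v n) with m in H by ring; lra.
        + pose proof (Cmod_triangle m (v n - m)) as H.
          replace (m + (v n - m)) with (v n) in H by ring; lra.
      - replace (Finite (Cmod m)) with (Finite (Cmod m - 0)) by (f_equal; ring).
        apply is_lim_seq_minus'; [apply is_lim_seq_const|assumption].
      - replace (Finite (Cmod m)) with (Finite (Cmod m + 0)) by (f_equal; ring).
        apply is_lim_seq_plus'; [apply is_lim_seq_const|assumption]. }
    assert (Hm' : (0 < Cmod m)%R) by now apply Cmod_gt_0.
    replace (Finite 0) with (Finite (0 * / (Cmod m * Cmod m)))
      by (f_equal; ring).
    apply is_lim_seq_mult'; [assumption|].
    apply (is_lim_seq_inv _ (Finite (Cmod m * Cmod m))).
    + apply is_lim_seq_mult'; [assumption|apply is_lim_seq_const].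
    + intros E; injection E; nra. }
now apply Ccvg_mult.
Qed.

Lemma Ccvg_filterlim (u : nat -> C) (l : C) :
  Ccvg u l -> filterlim u eventually (locally l).
Proof.
intros H P [e He].
destruct (Ccvg_eventually_lt u l e (cond_pos e) H) as [N HN].
exists N; intros n Hn; apply He; specialize (HN n Hn).
split; eapply Rle_lt_trans; try exact HN.
- apply (re_le_Cmod (u n - l)).
- apply (Im_le_Cmod (u n - l)).
Qed.

(** Real and imaginary parts are sums of increments dominated by a geometric series; the distance
    bound is the sum of that series. *)
Lemma Ccvg_cauchy_geom (u : nat -> C) (K r : R) :
  (0 <= r < 1)%R ->
  (forall n, (Cmod (u (S n) - u n) <= K * r ^ n)%R) ->
  exists l, Ccvg u l /\ (Cmod (l - u O) <= K / (1 - r))%R.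
Proof.
intros Hr H.
assert (Hg : is_series (fun n => K * r ^ n)%R (K * / (1 - r))%R).
{ apply (is_series_scal_l K (fun n => r ^ n)%R).
  apply is_series_geom; rewrite Rabs_pos_eq; lra. }
assert (Hs : forall g : C -> R,
  (forall x y : C, g (x - y) = (g x - g y)%R) ->
  (forall z, (Rabs (g z) <= Cmod z)%R) ->
  ex_finite_lim_seq (fun n => g (u n))).
{ intros g Hg1 Hg2.
  destruct (@ex_series_le R_AbsRing R_CompleteNormedModule
     (fun n => g (u (S n) - u n)) (fun n => K * r ^ n)%R) as [s Hs].
  - intros n; eapply Rle_trans; [apply Hg2|apply H].
  - now exists (K * / (1 - r))%R.
  - exists (g (u O) + s)%R; apply is_lim_seq_incr_1.
    apply is_lim_seq_ext with
      (fun n => g (u O) + sum_n (fun k => g (u (S k) - u k)%C) n)%R.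
    + intros n; induction n as [|n IH].
      * rewrite sum_O, Hg1; ring.
      * rewrite sum_Sn; unfold plus; simpl; rewrite <- Rplus_assoc, IH, Hg1; ring.
    + apply is_lim_seq_plus'; [apply is_lim_seq_const|exact Hs]. }
destruct (Hs Re) as [x Hx]; [reflexivity | apply re_le_Cmod |].
destruct (Hs Im) as [y Hy]; [reflexivity | apply Im_le_Cmod |].
assert (Hcv : Ccvg u (x, y)).
{ apply Ccvg_of_le with (fun n => Rabs (Re (u n) - x) + Rabs (Im (u n) - y))%R.
  - replace (Finite 0) with (Finite (0 + 0)) by (f_equal; ring).
    apply is_lim_seq_plus'; apply -> is_lim_seq_abs_0;
      match goal with |- is_lim_seq (fun n => _ - ?c)%R _ =>
        replace (Finite 0) with (Finite (c - c)) by (f_equal; ring) end;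
      apply is_lim_seq_minus'; auto; apply is_lim_seq_const.
  - intros n; unfold Cmod.
    replace (fst (u n - (x, y))) with (Re (u n) - x)%R by reflexivity.
    replace (snd (u n - (x, y))) with (Im (u n) - y)%R by reflexivity.
    rewrite <- (sqrt_Rsqr (Rabs (Re (u n) - x) + Rabs (Im (u n) - y))).
    + apply sqrt_le_1_alt; unfold Rsqr.
      rewrite <- (pow2_abs (Re (u n) - x)), <- (pow2_abs (Im (u n) - y)).
      pose proof (Rabs_pos (Re (u n) - x)); pose proof (Rabs_pos (Im (u n) - y)).
      nra.
    + apply Rplus_le_le_0_compat; apply Rabs_pos. }
exists (x, y); split; [assumption|].
assert (HK : (0 <= K)%R).
{ pose proof (H O) as H0; pose proof (Cmod_ge_0 (u 1%nat - u O)); simpl in H0; lra. }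
(* Subtracting the remaining geometric tail makes the bound exactly inductive. *)
assert (Hpart : forall n, (Cmod (u n - u O) <= K / (1 - r) - K * r ^ n / (1 - r))%R).
{ induction n as [|n IH].
  - replace (u O - u O) with (RtoC 0) by ring; rewrite Cmod_0; simpl.
    apply Req_le; field; lra.
  - replace (u (S n) - u O) with ((u (S n) - u n) + (u n - u O)) by ring.
    eapply Rle_trans; [apply Cmod_triangle|].
    eapply Rle_trans; [apply Rplus_le_compat; [apply H|apply IH]|].
    apply Req_le; simpl; field; lra. }
refine (is_lim_seq_le (fun _ => Cmod ((x, y) - u O))
  (fun n => K / (1 - r) + Cmod (u n - (x, y)))%R
  (Cmod ((x, y) - u O)) (K / (1 - r))%R _ _ _).
- intros n.
  assert (0 <= K * r ^ n / (1 - r))%R.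
  { apply Rmult_le_pos; [apply Rmult_le_pos; [lra|apply pow_le; lra]|].
    apply Rlt_le, Rinv_0_lt_compat; lra. }
  pose proof (Hpart n).
  pose proof (Cmod_triangle (u n - u O) (- (u n - (x, y)))) as T.
  rewrite Cmod_opp in T.
  replace (u n - u O + - (u n - (x, y))) with ((x, y) - u O) in T by ring.
  lra.
- apply is_lim_seq_const.
- replace (Finite (K / (1 - r))) with (Finite (K / (1 - r) + 0)) by (f_equal; ring).
  apply is_lim_seq_plus'; [apply is_lim_seq_const|exact Hcv].
Qed.

(** * Limits of continuants *)

(* Denominator of the fraction with coefficients b_k, a_{k+1}, b_{k+1}, ...,
   indexed so that n = 1 gives the empty continuant 1. *)
Fixpoint contin (a b : nat -> C) (n k : nat) : C :=
  match n with
  | O => 0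
  | S m =>
    match m with
    | O => 1
    | S p => b k * contin a b m (S k) + a (S k) * contin a b p (S (S k))
    end
  end.

Lemma contin_SS (a b : nat -> C) (n k : nat) :
  contin a b (S (S n)) k =
  b k * contin a b (S n) (S k) + a (S k) * contin a b n (S (S k)).
Proof. reflexivity. Qed.

(** In the infinite case the nonvanishing of [contin a b n (S k)] is recorded because, times the
    nonzero [a k], it is the next denominator, that of the fraction started one index earlier. *)
Lemma cf_from_contin (a b : nat -> C) (n k : nat) :
  (forall j, (1 <= j)%nat -> a j <> 0) -> (1 <= k)%nat ->
  (contin a b (S n) k <> 0 /\
   cf_from a b n k = Cfin (a k * contin a b n (S k) / contin a b (S n) k)) \/
  (contin a b (S n) k = 0 /\ contin a b n (S k) <> 0 /\
   cf_from a b n k = Cinf).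
Proof.
intros Ha; revert k; induction n as [|n IH]; intros k Hk.
- left; split; [exact C1_nz|].
  simpl; f_equal; field.
- change (cf_from a b (S n) k) with (cf_step (a k) (b k) (cf_from a b n (S k))).
  destruct (IH (S k)) as [[Hn E]|[Hn [Hm E]]]; [lia| |]; rewrite E; unfold cf_step.
  + assert (E' : b k + a (S k) * contin a b n (S (S k)) / contin a b (S n) (S k)
        = contin a b (S (S n)) k / contin a b (S n) (S k)).
    { rewrite contin_SS; now field. }
    rewrite E'; destruct (Ceq_dec _ 0) as [Z|Z].
    * right; split; [|now split].
      replace (contin a b (S (S n)) k)
        with (contin a b (S (S n)) k / contin a b (S n) (S k)
              * contin a b (S n) (S k)) by (now field).
      rewrite Z; ring.
    * assert (contin a b (S (S n)) k <> 0).
      { intros Z'; apply Z; rewrite Z'; now field. }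
      left; split; [assumption|]; f_equal; field; now split.
  + left; rewrite contin_SS, Hn; split.
    * rewrite Cmult_0_r, Cplus_0_l; apply Cmult_neq_0; auto; apply Ha; lia.
    * f_equal; rewrite Cmult_0_r; unfold Cdiv; ring.
Qed.

(** The shift pairs [b k] with [a (S k)], the two coefficients of the recurrence at index [k]. *)
Definition geom_close (M r : R) (a b : nat -> C) : Prop :=
  forall k, (Cmod (b k - 1) <= M * r ^ k /\ Cmod (a (S k)) <= M * r ^ k)%R.

(* Dominates the product of the factors [1 + 2 M r^j] over [j >= k]. *)
Definition weight (M r : R) (k : nat) : R := exp (2 * M * r ^ k / (1 - r)).

(** * Growth of solutions of perturbed backward recurrences *)

Section Weight.
Context (M r : R) (HM : (0 <= M)%R) (Hr : (0 <= r < 1)%R).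

Lemma geom_mul_nonneg k : (0 <= M * r ^ k)%R.
Proof. apply Rmult_le_pos; [assumption|apply pow_le; lra]. Qed.

(** The exponents at [k] and [S k] differ by [2 * (M * r ^ k)], and exp x >= 1 + x. *)
Lemma weight_step k : ((1 + 2 * (M * r ^ k)) * weight M r (S k) <= weight M r k)%R.
Proof.
unfold weight.
replace (2 * M * r ^ k / (1 - r))%R
  with (2 * (M * r ^ k) + 2 * M * r ^ (S k) / (1 - r))%R by (simpl; field; lra).
rewrite exp_plus; apply Rmult_le_compat_r; [apply Rlt_le, exp_pos|].
apply exp_ineq1_le.
Qed.

Lemma weight_ge_1 k : (1 <= weight M r k)%R.
Proof.
unfold weight; pose proof (geom_mul_nonneg k).
assert (0 <= 2 * M * r ^ k / (1 - r))%R.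
{ apply Rmult_le_pos; [lra|apply Rlt_le, Rinv_0_lt_compat; lra]. }
eapply Rle_trans; [|apply exp_ineq1_le]; lra.
Qed.

Lemma weight_decr k : (weight M r (S k) <= weight M r k)%R.
Proof.
pose proof (weight_step k); pose proof (geom_mul_nonneg k).
pose proof (weight_ge_1 (S k)); nra.
Qed.

Lemma weight_le_0 k : (weight M r k <= weight M r 0)%R.
Proof.
induction k as [|k IH]; [lra|]; eapply Rle_trans; [apply weight_decr|apply IH].
Qed.

(** Each step down multiplies a common bound for two consecutive values by at most 1 + 2 M r^j and
    adds eta r^j. The weight absorbs the product and the geometric sum collects the errors; carrying
    a consecutive pair lets the induction on [d] close. *)
Lemma backward_bound_finite (z : nat -> R) (eta S0 : R) (d k : nat) :
  (0 <= eta)%R -> (0 <= S0)%R ->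
  (forall j, (k <= j)%nat ->
    (z j <= (1 + M * r ^ j) * z (S j) + M * r ^ j * z (S (S j)) + eta * r ^ j)%R) ->
  (z (k + d)%nat <= S0)%R -> (z (S (k + d)) <= S0)%R ->
  (z k <= weight M r k * (S0 + eta * r ^ k / (1 - r)) /\
   z (S k) <= weight M r k * (S0 + eta * r ^ k / (1 - r)))%R.
Proof.
intros He HS; revert k; induction d as [|d IH]; intros k H H0 H1.
- rewrite Nat.add_0_r in *; pose proof (weight_ge_1 k).
  assert (0 <= eta * r ^ k / (1 - r))%R.
  { apply Rmult_le_pos; [apply Rmult_le_pos; [lra|apply pow_le; lra]|].
    apply Rlt_le, Rinv_0_lt_compat; lra. }
  split; nra.
- destruct (IH (S k)) as [B1 B2].
  + intros j Hj; apply H; lia.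
  + now replace (S k + d)%nat with (k + S d)%nat by lia.
  + now replace (S (S k + d))%nat with (S (k + S d))%nat by lia.
  + pose proof (weight_step k) as W; pose proof (weight_ge_1 k) as W1.
    pose proof (weight_ge_1 (S k)) as W2.
    pose proof (geom_mul_nonneg k) as G.
    pose proof (H k (Nat.le_refl k)) as Hk.
    set (B := (S0 + eta * r ^ S k / (1 - r))%R) in *.
    assert (HB : (0 <= B)%R).
    { apply Rplus_le_le_0_compat; [assumption|].
      apply Rmult_le_pos; [apply Rmult_le_pos; [lra|apply pow_le; lra]|].
      apply Rlt_le, Rinv_0_lt_compat; lra. }
    assert (Hek : (0 <= eta * r ^ k)%R)
      by (apply Rmult_le_pos; [lra|apply pow_le; lra]).
    replace (S0 + eta * r ^ k / (1 - r))%R with (B + eta * r ^ k)%R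
      by (unfold B; simpl; field; lra).
    assert (WB : ((1 + 2 * (M * r ^ k)) * (weight M r (S k) * B)
                  <= weight M r k * B)%R).
    { rewrite <- Rmult_assoc; now apply Rmult_le_compat_r. }
    assert (WE : (eta * r ^ k <= weight M r k * (eta * r ^ k))%R) by nra.
    assert (WBpos : (0 <= weight M r (S k) * B)%R)
      by (apply Rmult_le_pos; lra).
    rewrite Rmult_plus_distr_l; split; [|nra].
    assert (M * r ^ k * z (S (S k)) <= M * r ^ k * (weight M r (S k) * B))%R
      by (now apply Rmult_le_compat_l).
    assert ((1 + M * r ^ k) * z (S k) <= (1 + M * r ^ k) * (weight M r (S k) * B))%R
      by (apply Rmult_le_compat_l; lra).
    lra.
Qed.

Lemma backward_bound (Z : nat -> C) (eta : R) (k : nat) :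
  (0 <= eta)%R ->
  (forall j, (k <= j)%nat ->
    (Cmod (Z j) <= (1 + M * r ^ j) * Cmod (Z (S j))
       + M * r ^ j * Cmod (Z (S (S j))) + eta * r ^ j)%R) ->
  Ccvg Z 0 ->
  (Cmod (Z k) <= weight M r 0 * eta / (1 - r))%R.
Proof.
intros He H HZ.
apply Rle_trans with (weight M r k * (0 + eta * r ^ k / (1 - r)))%R.
(* Far out, two consecutive values are below [e / weight M r k]; after multiplication by the weight
   this boundary term contributes exactly [e], so only the [eta] term survives. *)
- apply le_epsilon; intros e Hpos.
  pose proof (weight_ge_1 k) as W.
  destruct (Ccvg_eventually_lt Z 0 (e / weight M r k)) as [N HN]; auto.
  { apply Rdiv_lt_0_compat; lra. }
  assert (HN' : forall n, (N <= n)%nat -> (Cmod (Z n) <= e / weight M r k)%R).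
  { intros n Hn; apply Rlt_le; replace (Z n) with (Z n - 0) by ring; auto. }
  destruct (backward_bound_finite (fun j => Cmod (Z j)) eta (e / weight M r k) N k)
    as [B _]; auto.
  + apply Rlt_le, Rdiv_lt_0_compat; lra.
  + apply HN'; lia.
  + apply HN'; lia.
  + eapply Rle_trans; [apply B|]; apply Req_le; field; lra.
- rewrite Rplus_0_l; unfold Rdiv; rewrite <- Rmult_assoc.
  apply Rmult_le_compat_r; [apply Rlt_le, Rinv_0_lt_compat; lra|].
  pose proof (weight_le_0 k); pose proof (weight_ge_1 k).
  assert (0 <= r ^ k <= 1)%R.
  { split; [apply pow_le; lra|].
    rewrite <- (pow1 k); apply pow_incr; lra. }
  apply Rmult_le_compat; nra.
Qed.
End Weight.

(** * Geometric convergence of the continuants *)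

Section Tail.
Context (M r : R) (HM : (0 <= M)%R) (Hr : (0 < r < 1)%R) (a b : nat -> C)
  (Hab : geom_close M r a b).

Lemma Cmod_den_le k : (Cmod (b k) <= 1 + M * r ^ k)%R.
Proof.
replace (b k) with (1 + (b k - 1)) by ring.
eapply Rle_trans; [apply Cmod_triangle|]; rewrite Cmod_1.
apply Rplus_le_compat_l, Hab.
Qed.

(** The differences obey the continuant recurrence, whose two right-hand terms have the same index
    sum as the left side; hence the single factor [r ^ (k + n)], while [weight] absorbs the growth.
    The constant comes from the case n = 1: there the bound is (2 + M) M r^k, and a factor [r] is
    divided out to reach r^(k+1). *)
Lemma contin_diff n k :
  (Cmod (contin a b (S (S n)) k - contin a b (S n) k)
   <= (2 + M) * M / r * weight M r k * r ^ (k + n))%R.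
Proof.
assert (Hr' : (0 <= r < 1)%R) by lra.
assert (HK : (0 <= (2 + M) * M / r)%R).
{ apply Rmult_le_pos; [nra|apply Rlt_le, Rinv_0_lt_compat; lra]. }
assert (W1 : forall k, ((2 + M) * M / r <= (2 + M) * M / r * weight M r k)%R).
{ intros j; pose proof (weight_ge_1 M r HM Hr' j); nra. }
assert (P : forall j, (0 < r ^ j)%R) by (intros; apply pow_lt; lra).
revert k.
(* The recurrence goes back two steps in [n], so two consecutive differences are carried along. *)
enough (H : forall k,
  (Cmod (contin a b (S (S n)) k - contin a b (S n) k)
   <= (2 + M) * M / r * weight M r k * r ^ (k + n))%R /\
  (Cmod (contin a b (S (S (S n))) k - contin a b (S (S n)) k)
   <= (2 + M) * M / r * weight M r k * r ^ (k + S n))%R) by apply H.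
induction n as [|n IH]; intros k.
- destruct (Hab k) as [B1 A1]; destruct (Hab (S k)) as [B2 _]; split.
  + replace (contin a b 2 k - contin a b 1 k) with (b k - 1) by (simpl; ring).
    rewrite Nat.add_0_r; eapply Rle_trans; [apply B1|].
    apply Rmult_le_compat_r; [apply Rlt_le, P|].
    eapply Rle_trans; [|apply W1].
    apply Rmult_le_reg_r with r; [lra|].
    replace ((2 + M) * M / r * r)%R with ((2 + M) * M)%R by (field; lra); nra.
  + replace (contin a b 3 k - contin a b 2 k)
      with (b k * (b (S k) - 1) + a (S k)) by (simpl; ring).
    eapply Rle_trans; [apply Cmod_triangle|]; rewrite Cmod_mult.
    apply Rle_trans with ((1 + M) * (M * r ^ k) + M * r ^ k)%R.
    * apply Rplus_le_compat; [|assumption].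
      apply Rmult_le_compat; try apply Cmod_ge_0.
      -- eapply Rle_trans; [apply Cmod_den_le|].
         assert (r ^ k <= 1)%R by (rewrite <- (pow1 k); apply pow_incr; lra).
         nra.
      -- eapply Rle_trans; [apply B2|]; apply Rmult_le_compat_l; [lra|].
         simpl; specialize (P k); nra.
    * apply Rle_trans with ((2 + M) * M / r * r ^ (k + 1))%R.
      -- rewrite pow_add, pow_1; apply Req_le; field; lra.
      -- apply Rmult_le_compat_r; [apply Rlt_le, P|apply W1].
- split; [apply IH|].
  rewrite (contin_SS a b (S (S n))), (contin_SS a b (S n) k).
  match goal with |- (Cmod (?x * ?y + ?z * ?t - (_ * ?u + _ * ?v)) <= _)%R =>
    replace (x * y + z * t - (x * u + z * v))
      with (x * (y - u) + z * (t - v)) by ring end.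
  eapply Rle_trans; [apply Cmod_triangle|]; rewrite !Cmod_mult.
  destruct (IH (S k)) as [_ I1]; destruct (IH (S (S k))) as [I2 _].
  set (K := ((2 + M) * M / r)%R) in *.
  pose proof (geom_mul_nonneg M r HM Hr' k) as G.
  pose proof (weight_step M r Hr' k) as S1.
  pose proof (weight_decr M r HM Hr' (S k)) as S2.
  pose proof (weight_ge_1 M r HM Hr' (S k)) as S3.
  replace (S k + S n)%nat with (k + S (S n))%nat in I1 by lia.
  replace (S (S k) + n)%nat with (k + S (S n))%nat in I2 by lia.
  set (p := (r ^ (k + S (S n)))%R) in *.
  assert (Hp : (0 < p)%R) by apply P.
  apply Rle_trans with ((1 + M * r ^ k) * (K * weight M r (S k) * p)
     + M * r ^ k * (K * weight M r (S k) * p))%R.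
  + apply Rplus_le_compat; apply Rmult_le_compat; try apply Cmod_ge_0.
    * apply Cmod_den_le.
    * exact I1.
    * apply Hab.
    * eapply Rle_trans; [exact I2|].
      apply Rmult_le_compat_r; [lra|]; apply Rmult_le_compat_l; lra.
  + replace ((1 + M * r ^ k) * (K * weight M r (S k) * p)
     + M * r ^ k * (K * weight M r (S k) * p))%R
     with (K * ((1 + 2 * (M * r ^ k)) * weight M r (S k)) * p)%R by ring.
    apply Rmult_le_compat_r; [lra|]; now apply Rmult_le_compat_l.
Qed.
End Tail.

(** * The limiting solution of the recurrence: rate, stability, uniqueness *)

Definition cf_tail (a b : nat -> C) (k : nat) : C :=
  @iota C_CompleteNormedModule (fun l : C => Ccvg (fun n => contin a b n k) l).

Section TailLimit.
Context (M r : R) (HM : (0 <= M)%R) (Hr : (0 < r < 1)%R) (a b : nat -> C)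
  (Hab : geom_close M r a b).

(** The continuant with n = 1 is 1, so the distance from the first term is the distance from 1; its
    decay in [k] gives [cf_tail_lim]. *)
Lemma contin_cvg_aux k :
  exists l, Ccvg (fun n => contin a b n k) l /\
  (Cmod (l - 1) <= (2 + M) * M / r * weight M r 0 / (1 - r) * r ^ k)%R.
Proof.
destruct (Ccvg_cauchy_geom (fun n => contin a b (S n) k)
  ((2 + M) * M / r * weight M r k * r ^ k) r) as [l [H1 H2]].
- lra.
- intros n; eapply Rle_trans; [apply (contin_diff M r); auto|].
  rewrite pow_add; apply Req_le; ring.
- exists l; split; [now apply is_lim_seq_incr_1|].
  eapply Rle_trans; [exact H2|].
  replace ((2 + M) * M / r * weight M r k * r ^ k / (1 - r))%R
    with ((2 + M) * M / r * weight M r k / (1 - r) * r ^ k)%R by (field; lra).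
  apply Rmult_le_compat_r; [apply pow_le; lra|].
  apply Rmult_le_compat_r; [apply Rlt_le, Rinv_0_lt_compat; lra|].
  apply Rmult_le_compat_l.
  + apply Rmult_le_pos; [nra|apply Rlt_le, Rinv_0_lt_compat; lra].
  + apply weight_le_0; lra.
Qed.

Lemma contin_cvg k : Ccvg (fun n => contin a b n k) (cf_tail a b k).
Proof.
destruct (contin_cvg_aux k) as [l [Hl _]].
replace (cf_tail a b k) with l; [assumption|].
symmetry; apply (@iota_unique C_AbsRing C_CompleteNormedModule); [|assumption].
intros y Hy; now apply (Ccvg_unique _ _ _ Hy).
Qed.

Lemma cf_tail_rec k :
  cf_tail a b k = b k * cf_tail a b (S k) + a (S k) * cf_tail a b (S (S k)).
Proof.
apply (Ccvg_unique (fun n => contin a b (n + 2)%nat k)).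
- apply (Ccvg_shift (fun n => contin a b n k)), contin_cvg.
- apply Ccvg_ext with
    (fun n => b k * contin a b (n + 1)%nat (S k) + a (S k) * contin a b n (S (S k))).
  + intros n; replace (n + 2)%nat with (S (S n)) by lia.
    now replace (n + 1)%nat with (S n) by lia.
  + apply Ccvg_plus; apply Ccvg_mult; try apply Ccvg_const.
    * apply (Ccvg_shift (fun n => contin a b n (S k))), contin_cvg.
    * apply contin_cvg.
Qed.

Lemma cf_tail_lim : Ccvg (cf_tail a b) 1.
Proof.
apply Ccvg_of_le with
  (fun k => (2 + M) * M / r * weight M r 0 / (1 - r) * r ^ k)%R.
- set (K := ((2 + M) * M / r * weight M r 0 / (1 - r))%R).
  replace (Finite 0) with (Rbar_mult K 0) by (simpl; f_equal; ring).
  apply is_lim_seq_scal_l, is_lim_seq_geom; rewrite Rabs_pos_eq; lra.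
- intros k; destruct (contin_cvg_aux k) as [l [Hl B]].
  now rewrite (Ccvg_unique _ _ _ (contin_cvg k) Hl).
Qed.

(** The error satisfies the inequality of [backward_bound]. Taking [eta] zero yields uniqueness;
    taking it small yields continuity at zero parameters. *)
Lemma cf_tail_perturb (X : nat -> C) (eta : R) (k : nat) :
  (0 <= eta)%R ->
  (forall j, (k <= j)%nat ->
    (Cmod (X j - (b j * X (S j) + a (S j) * X (S (S j)))) <= eta * r ^ j)%R) ->
  Ccvg X 1 ->
  (Cmod (cf_tail a b k - X k) <= weight M r 0 * eta / (1 - r))%R.
Proof.
intros He H HX.
apply (backward_bound M r HM ltac:(lra) (fun j => cf_tail a b j - X j)); auto.
- intros j Hj.
  replace (cf_tail a b j - X j) with
    (b j * (cf_tail a b (S j) - X (S j))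
     + a (S j) * (cf_tail a b (S (S j)) - X (S (S j)))
     + - (X j - (b j * X (S j) + a (S j) * X (S (S j)))))
    by (rewrite (cf_tail_rec j); ring).
  eapply Rle_trans; [apply Cmod_triangle|]; rewrite Cmod_opp.
  apply Rplus_le_compat; [|now apply H].
  eapply Rle_trans; [apply Cmod_triangle|]; rewrite !Cmod_mult.
  apply Rplus_le_compat; apply Rmult_le_compat_r; try apply Cmod_ge_0.
  + now apply (Cmod_den_le M r a).
  + apply Hab.
- replace (RtoC 0) with (1 + - (1) * 1) by ring.
  apply Ccvg_ext with (fun j => cf_tail a b j + - (1) * X j).
  + intros n; ring.
  + apply Ccvg_plus; [apply cf_tail_lim|].
    apply Ccvg_mult; [apply Ccvg_const|assumption].
Qed.

(** The recurrence is asked for only from [k] on, which fits [bauer_muir], whose value at 0 is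
    junk. *)
Lemma cf_tail_unique (X : nat -> C) (k : nat) :
  (forall j, (k <= j)%nat -> X j = b j * X (S j) + a (S j) * X (S (S j))) ->
  Ccvg X 1 -> cf_tail a b k = X k.
Proof.
intros H HX.
assert (B : (Cmod (cf_tail a b k - X k) <= weight M r 0 * 0 / (1 - r))%R).
{ apply cf_tail_perturb; auto; [lra|].
  intros j Hj; rewrite <- (H j Hj).
  replace (X j - X j) with (RtoC 0) by ring; rewrite Cmod_0; lra. }
replace (weight M r 0 * 0 / (1 - r))%R with 0%R in B by (field; lra).
assert (E : cf_tail a b k - X k = 0).
{ apply Cmod_eq_0, Rle_antisym; [assumption|apply Cmod_ge_0]. }
replace (cf_tail a b k) with ((cf_tail a b k - X k) + X k) by ring.
rewrite E; ring.
Qed.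
End TailLimit.

(** * The q-continued fraction *)

Section Tails.
Context (q : C) (Hq0 : q <> 0) (Hq : (Cmod q < 1)%R).

(** * Closed forms and size of the coefficients *)

Lemma Cmod_q_bounds : (0 < Cmod q < 1)%R.
Proof. split; [now apply Cmod_gt_0|assumption]. Qed.

Lemma cf_num_2j1 (a b : C) (j : nat) :
  cf_num a b q (S (2 * j)) =
  (1 - a ^ 2 * (q * q ^ (2 * j))) * (1 - b ^ 2 * (q * q ^ (2 * j))) * q ^ (2 * j).
Proof.
replace (S (2 * j)) with (2 * (S j) - 1)%nat by lia.
rewrite cf_num_odd by lia.
replace (2 * S j - 1)%nat with (S (2 * j)) by lia.
now replace (2 * S j - 2)%nat with (2 * j)%nat by lia.
Qed.

Lemma cf_num_2j2 (a b : C) (j : nat) :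
  cf_num a b q (S (S (2 * j))) =
  (a - b * (q * q ^ (2 * j))) * (b - a * (q * q ^ (2 * j)))
    * (q ^ 2 * q ^ (2 * j)).
Proof.
replace (S (S (2 * j))) with (2 * (S j))%nat by lia.
rewrite cf_num_even.
replace (2 * S j - 1)%nat with (S (2 * j)) by lia.
replace (2 * S j)%nat with (2 + 2 * j)%nat by lia.
now rewrite Cpow_add_r.
Qed.

Lemma cf_den_sqr (a b : C) (k : nat) :
  cf_den a b q k = 1 - a * b * (q ^ k * q ^ k).
Proof.
unfold cf_den; replace (2 * k)%nat with (k + k)%nat by lia.
now rewrite Cpow_add_r.
Qed.

(** At zero parameters the odd-indexed numerators are powers of [q], so the comparison is with them
    rather than with 0. The deviation vanishes with [l], which drives [tail_continuous_0]. *)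
Lemma cf_coeffs_near_0 (a b : C) (l : R) (k : nat) :
  (Cmod a <= l)%R -> (Cmod b <= l)%R ->
  (Cmod (cf_den a b q k - 1) <= l ^ 2 * Cmod q ^ k)%R /\
  (Cmod (cf_num a b q (S k) - cf_num 0 0 q (S k))
     <= (4 * l ^ 2 + l ^ 4) * Cmod q ^ k)%R.
Proof.
intros Ha Hb.
pose proof Cmod_q_bounds as Hr; set (r := Cmod q) in *.
assert (P : forall n, (0 < r ^ n <= 1)%R).
{ intros n; split; [apply pow_lt; lra|].
  rewrite <- (pow1 n); apply pow_incr; lra. }
pose proof (Cmod_ge_0 a) as Pa; pose proof (Cmod_ge_0 b) as Pb.
assert (Hab : (Cmod a * Cmod b <= l ^ 2)%R) by nra.
split.
- rewrite cf_den_sqr.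
  replace (1 - a * b * (q ^ k * q ^ k) - 1) with (- (a * b * (q ^ k * q ^ k)))
    by ring.
  rewrite Cmod_opp, !Cmod_mult, Cmod_pow; fold r.
  pose proof (P k).
  apply Rmult_le_compat; nra.
- assert (Hx : forall x y : C, (Cmod (x - y) <= Cmod x + Cmod y)%R).
  { intros x y; rewrite <- (Cmod_opp y); apply Cmod_triangle. }
  destruct (Nat.Even_or_Odd k) as [[j ->]|[j ->]].
  (* Odd-indexed numerator: [l ^ 4] bounds the term with (ab)^2, and [2 * l ^ 2] the term with a^2 +
     b^2. *)
  + rewrite !cf_num_2j1; set (p := q ^ (2 * j)).
    assert (Hp : Cmod p = (r ^ (2 * j))%R) by apply Cmod_pow.
    rewrite <- Hp.
    assert (Hp1 : (0 < Cmod p <= 1)%R) by (rewrite Hp; apply P).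
    replace ((1 - a ^ 2 * (q * p)) * (1 - b ^ 2 * (q * p)) * p
       - (1 - 0 ^ 2 * (q * p)) * (1 - 0 ^ 2 * (q * p)) * p)
      with (((a * b) ^ 2 * (q * p) ^ 2 - (a ^ 2 + b ^ 2) * (q * p)) * p) by ring.
    rewrite Cmod_mult; apply Rmult_le_compat_r; [lra|].
    eapply Rle_trans; [apply Hx|].
    rewrite !Cmod_mult, !Cmod_pow, !Cmod_mult; fold r.
    assert (Hqp : (0 <= r * Cmod p <= 1)%R) by nra.
    assert (H1 : (Cmod (a ^ 2 + b ^ 2) <= 2 * l ^ 2)%R).
    { eapply Rle_trans; [apply Cmod_triangle|]; rewrite !Cmod_pow; nra. }
    pose proof (Cmod_ge_0 (a ^ 2 + b ^ 2)).
    assert (H2 : ((Cmod a * Cmod b) ^ 2 <= l ^ 4)%R).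
    { replace (l ^ 4)%R with ((l ^ 2) ^ 2)%R by ring; apply pow_incr; nra. }
    assert ((Cmod a * Cmod b) ^ 2 * (r * Cmod p) ^ 2 <= l ^ 4)%R.
    { assert (0 <= (Cmod a * Cmod b) ^ 2)%R by apply pow2_ge_0.
      assert ((r * Cmod p) ^ 2 <= 1)%R by nra; nra. }
    nra.
  (* Even-indexed numerator: each of the two factors is at most [2 * l], and q^2 supplies the extra
     power of [r]. *)
  + replace (S (2 * j + 1)) with (S (S (2 * j))) by lia.
    rewrite !cf_num_2j2, pow_add, pow_1; set (p := q ^ (2 * j)).
    assert (Hp : Cmod p = (r ^ (2 * j))%R) by apply Cmod_pow.
    rewrite <- Hp.
    assert (Hp1 : (0 < Cmod p <= 1)%R) by (rewrite Hp; apply P).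
    assert (Hqp : (0 <= r * Cmod p <= 1)%R) by nra.
    assert (Hf : forall x y : C, (Cmod x <= l)%R -> (Cmod y <= l)%R ->
      (Cmod (x - y * (q * p)) <= 2 * l)%R).
    { intros x y Hx1 Hy1; eapply Rle_trans; [apply Hx|].
      rewrite !Cmod_mult; fold r; pose proof (Cmod_ge_0 y); nra. }
    pose proof (Hf a b Ha Hb) as F1; pose proof (Hf b a Hb Ha) as F2.
    pose proof (Cmod_ge_0 (a - b * (q * p))) as G1.
    pose proof (Cmod_ge_0 (b - a * (q * p))) as G2.
    match goal with |- (Cmod (_ - ?z) <= _)%R =>
      replace z with (RtoC 0) by ring end.
    unfold Cminus at 1; rewrite Copp_0, Cplus_0_r.
    rewrite !(Cmod_mult _ (_ * p)), Cmod_mult, (Cmod_mult _ p), Cmod_pow; fold r.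
    apply Rmult_le_compat.
    * now apply Rmult_le_pos.
    * nra.
    * assert (0 <= l ^ 4)%R.
      { replace (l ^ 4)%R with ((l ^ 2) ^ 2)%R by ring; apply pow2_ge_0. }
      nra.
    * nra.
Qed.

(** The summand 1 bounds the numerators at zero parameters, the rest their deviation. The constant
    depends only on [l], so it serves all smaller parameters at once. *)
Lemma cf_geom_close (a b : C) (l : R) :
  (Cmod a <= l)%R -> (Cmod b <= l)%R ->
  geom_close (1 + 4 * l ^ 2 + l ^ 4) (Cmod q) (cf_num a b q) (cf_den a b q).
Proof.
intros Ha Hb k; destruct (cf_coeffs_near_0 a b l k Ha Hb) as [H1 H2].
assert (Pq : (0 <= Cmod q ^ k)%R) by apply pow_le, Cmod_ge_0.
assert (Hl4 : (0 <= l ^ 4)%R).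
{ replace (l ^ 4)%R with ((l ^ 2) ^ 2)%R by ring; apply pow2_ge_0. }
pose proof (pow2_ge_0 l) as Hl2.
split; [nra|].
assert (H0 : (Cmod (cf_num 0 0 q (S k)) <= Cmod q ^ k)%R).
{ destruct (Nat.Even_or_Odd k) as [[j ->]|[j ->]].
  - rewrite cf_num_2j1; apply Req_le; rewrite <- Cmod_pow; f_equal; ring.
  - replace (S (2 * j + 1)) with (S (S (2 * j))) by lia.
    rewrite cf_num_2j2.
    match goal with |- (Cmod ?z <= _)%R => replace z with (RtoC 0) by ring end.
    now rewrite Cmod_0. }
replace (cf_num a b q (S k))
  with (cf_num 0 0 q (S k) + (cf_num a b q (S k) - cf_num 0 0 q (S k))) by ring.
eapply Rle_trans; [apply Cmod_triangle|]; nra.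
Qed.

Lemma cf_geom_close_ex (a b : C) :
  exists M, (0 <= M)%R /\
    geom_close M (Cmod q) (cf_num a b q) (cf_den a b q).
Proof.
set (l := Rmax (Cmod a) (Cmod b)).
exists (1 + 4 * l ^ 2 + l ^ 4)%R; split.
- replace (l ^ 4)%R with ((l ^ 2) ^ 2)%R by ring.
  pose proof (pow2_ge_0 l); pose proof (pow2_ge_0 (l ^ 2)); lra.
- apply cf_geom_close; [apply Rmax_l|apply Rmax_r].
Qed.

(** * The solutions X_k(a,b) and their Bauer-Muir transform *)

Definition tail (a b : C) : nat -> C := cf_tail (cf_num a b q) (cf_den a b q).

Lemma tail_cvg (a b : C) (k : nat) :
  Ccvg (fun n => contin (cf_num a b q) (cf_den a b q) n k) (tail a b k).
Proof.
destruct (cf_geom_close_ex a b) as [M [HM H]].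
exact (contin_cvg M (Cmod q) HM Cmod_q_bounds _ _ H k).
Qed.

Lemma tail_rec (a b : C) (k : nat) :
  tail a b k = cf_den a b q k * tail a b (S k)
               + cf_num a b q (S k) * tail a b (S (S k)).
Proof.
destruct (cf_geom_close_ex a b) as [M [HM H]].
exact (cf_tail_rec M (Cmod q) HM Cmod_q_bounds _ _ H k).
Qed.

Lemma tail_lim (a b : C) : Ccvg (tail a b) 1.
Proof.
destruct (cf_geom_close_ex a b) as [M [HM H]].
exact (cf_tail_lim M (Cmod q) HM Cmod_q_bounds _ _ H).
Qed.

(* Indexed for [k >= 1]; [Nat.pred 0 = 0] makes the value at [0] junk. *)
Definition bauer_muir (a b : C) (k : nat) : C :=
  tail (a * q) (b * q) (Nat.pred k)
  - (if Nat.odd k then cf_den a b q 1 * q ^ Nat.pred k else 0)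
    * tail (a * q) (b * q) k.

Lemma bauer_muir_lim (a b : C) : Ccvg (bauer_muir a b) 1.
Proof.
(* After the shift by one [Nat.pred] disappears, and [c k] is the coefficient of the second term, at
   most a constant times |q|^k. *)
apply is_lim_seq_incr_1.
set (c := fun k =>
  if Nat.odd (S k) then - (cf_den a b q 1 * q ^ k) else - (0)).
assert (Hc : Ccvg c 0).
{ apply Ccvg_of_le with (fun k => Cmod (cf_den a b q 1) * Cmod q ^ k)%R.
  - replace (Finite 0) with (Rbar_mult (Cmod (cf_den a b q 1)) 0)
      by (simpl; f_equal; ring).
    apply is_lim_seq_scal_l, is_lim_seq_geom.
    rewrite Rabs_pos_eq; [assumption|apply Cmod_ge_0].
  - intros k; unfold c; destruct (Nat.odd (S k)).
    + replace (- (cf_den a b q 1 * q ^ k) - 0)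
        with (- (cf_den a b q 1 * q ^ k)) by ring.
      rewrite Cmod_opp, Cmod_mult, Cmod_pow; lra.
    + replace (- (0) - 0) with (RtoC 0) by ring; rewrite Cmod_0.
      apply Rmult_le_pos; [|apply pow_le]; apply Cmod_ge_0. }
change (Ccvg (fun k => bauer_muir a b (S k)) 1).
replace (RtoC 1) with (1 + 0 * 1) by ring.
apply Ccvg_ext with
  (fun k => tail (a * q) (b * q) k + c k * tail (a * q) (b * q) (k + 1)%nat).
- intros k; unfold bauer_muir, c; rewrite Nat.add_1_r; simpl Nat.pred.
  destruct (Nat.odd (S k)); ring.
- apply Ccvg_plus; [apply tail_lim|]; apply Ccvg_mult; [exact Hc|].
  apply Ccvg_shift, tail_lim.
Qed.

Lemma bauer_muir_odd (a b : C) (j : nat) :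
  bauer_muir a b (S (2 * j)) =
  tail (a * q) (b * q) (2 * j)
  - cf_den a b q 1 * q ^ (2 * j) * tail (a * q) (b * q) (S (2 * j)).
Proof.
unfold bauer_muir; replace (Nat.odd (S (2 * j))) with true; [reflexivity|].
now rewrite Nat.odd_succ, Nat.even_even.
Qed.

Lemma bauer_muir_even (a b : C) (j : nat) :
  bauer_muir a b (S (S (2 * j))) = tail (a * q) (b * q) (S (2 * j)).
Proof.
unfold bauer_muir; replace (Nat.odd (S (S (2 * j)))) with false; [cbv beta iota delta [Nat.pred]; ring|].
now rewrite Nat.odd_succ, Nat.even_succ, Nat.odd_even.
Qed.

(** The denominator b_k at (aq,bq) is b_{k+1} at (a,b). Expanding by [tail_rec] down to two
    consecutive Y leaves, in either parity, the identity N_i = q^2 n_i + b_1 b_{2i} with i = k/2 or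
    i = (k+1)/2. *)
Lemma bauer_muir_rec (a b : C) (k : nat) :
  (1 <= k)%nat ->
  bauer_muir a b k = cf_den a b q k * bauer_muir a b (S k)
                     + cf_num a b q (S k) * bauer_muir a b (S (S k)).
Proof.
intros Hk.
destruct (Nat.Even_or_Odd k) as [[j ->]|[j ->]].
- destruct j as [|j]; [lia|].
  replace (2 * S j)%nat with (S (S (2 * j))) by lia.
  rewrite bauer_muir_even.
  replace (S (S (2 * j))) with (2 * S j)%nat by lia.
  rewrite bauer_muir_odd, bauer_muir_even, cf_num_2j1.
  rewrite (tail_rec _ _ (S (2 * j))), cf_num_2j2, !cf_den_sqr.
  replace (2 * S j)%nat with (S (S (2 * j))) by lia.
  rewrite !Cpow_S; simpl (q ^ 0); ring.
- rewrite Nat.add_1_r, bauer_muir_even, bauer_muir_odd.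
  replace (S (S (S (2 * j)))) with (S (2 * S j)) by lia.
  rewrite bauer_muir_odd, cf_num_2j2.
  rewrite (tail_rec _ _ (2 * j)), cf_num_2j1, (tail_rec _ _ (S (2 * j))).
  rewrite cf_num_2j2, !cf_den_sqr.
  replace (2 * S j)%nat with (S (S (2 * j))) by lia.
  rewrite !Cpow_S; simpl (q ^ 0); ring.
Qed.
Lemma tail_bauer_muir (a b : C) (k : nat) :
  (1 <= k)%nat -> tail a b k = bauer_muir a b k.
Proof.
intros Hk; destruct (cf_geom_close_ex a b) as [M [HM H]].
apply (cf_tail_unique M (Cmod q) HM Cmod_q_bounds _ _ H); [|apply bauer_muir_lim].
intros j Hj; apply bauer_muir_rec; lia.
Qed.

Lemma tail_2 (a b : C) : tail a b 2 = tail (a * q) (b * q) 1.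
Proof.
rewrite tail_bauer_muir by lia; exact (bauer_muir_even a b 0).
Qed.

(** Here X_1 = Y_0 - b_1 Y_1. The recurrence for Y_0 has leading coefficient 1 - abq^2 = b_1, so Y_1
    cancels and only the numerator times Y_2 remains, to which [tail_2] applies. *)
Lemma tail_1 (a b : C) :
  tail a b 1 = (1 - a ^ 2 * q ^ 3) * (1 - b ^ 2 * q ^ 3)
               * tail (a * q ^ 2) (b * q ^ 2) 1.
Proof.
rewrite (tail_bauer_muir a b 1) by lia.
rewrite (bauer_muir_odd a b 0 : bauer_muir a b 1 = _).
rewrite (tail_rec _ _ (2 * 0)), cf_num_2j1, !cf_den_sqr.
replace (a * q ^ 2) with (a * q * q) by ring.
replace (b * q ^ 2) with (b * q * q) by ring.
change (S (S (2 * 0))) with 2%nat; rewrite tail_2; simpl; ring.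
Qed.

(** Each application of [tail_1] multiplies a^2 and b^2 by q^4, whence the base of the products. *)
Lemma tail_1_iter (a b : C) (m : nat) :
  tail a b 1 = qpoch_fin (a ^ 2 * q ^ 3) (q ^ 4) m
               * qpoch_fin (b ^ 2 * q ^ 3) (q ^ 4) m
               * tail (a * q ^ (2 * m)) (b * q ^ (2 * m)) 1.
Proof.
induction m as [|m IH].
- simpl; rewrite !Cmult_1_r, Cmult_1_l; reflexivity.
- rewrite IH, (tail_1 (a * q ^ (2 * m))).
  replace (2 * S m)%nat with (2 * m + 2)%nat by lia.
  rewrite Cpow_add_r, !Cmult_assoc; cbn [qpoch_fin].
  rewrite <- Cpow_mult_r.
  replace (4 * m)%nat with (2 * m + 2 * m)%nat by lia.
  rewrite Cpow_add_r; ring.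
Qed.

(** * Passage to zero parameters *)

Lemma tail_bounded (a b : C) :
  exists B, forall k, (Cmod (tail a b k) <= B)%R.
Proof.
destruct (filterlim_bounded (K := R_AbsRing) (V := R_NormedModule)
  (fun k => Cmod (tail a b k - 1))) as [B HB].
{ exists 0%R; exact (tail_lim a b). }
exists (B + 1)%R; intros k.
replace (tail a b k) with ((tail a b k - 1) + 1) by ring.
eapply Rle_trans; [apply Cmod_triangle|]; rewrite Cmod_1.
apply Rplus_le_compat_r; eapply Rle_trans; [|apply (HB k)]; apply Rle_abs.
Qed.

(** The exact solution [tail 0 0] solves the recurrence with parameters (a q^(2m), b q^(2m)) up to
    the difference of the coefficients, so [cf_tail_perturb] applies with a defect of order
    |q|^m. *)
Lemma tail_continuous_0 (a b : C) :
  Ccvg (fun m => tail (a * q ^ (2 * m)) (b * q ^ (2 * m)) 1) (tail 0 0 1).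
Proof.
pose proof Cmod_q_bounds as Hr; set (r := Cmod q) in *.
set (L := Rmax (Cmod a) (Cmod b)).
assert (HL : (0 <= L)%R) by (eapply Rle_trans; [apply Cmod_ge_0|apply Rmax_l]).
assert (HL4 : (0 <= L ^ 4)%R) by (apply pow_le; assumption).
assert (HL2 : (0 <= L ^ 2)%R) by (apply pow_le; assumption).
destruct (tail_bounded 0 0) as [B HB].
assert (HB0 : (0 <= B)%R) by (eapply Rle_trans; [apply Cmod_ge_0|apply (HB O)]).
set (M := (1 + 4 * L ^ 2 + L ^ 4)%R).
assert (HM : (0 <= M)%R) by (unfold M; lra).
apply Ccvg_of_le with
  (fun m => weight M r 0 * ((5 * L ^ 2 + L ^ 4) * B) / (1 - r) * r ^ m)%R.
{ set (K := (weight M r 0 * ((5 * L ^ 2 + L ^ 4) * B) / (1 - r))%R).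
  replace (Finite 0) with (Rbar_mult K 0) by (simpl; f_equal; ring).
  apply is_lim_seq_scal_l, is_lim_seq_geom; rewrite Rabs_pos_eq; lra. }
intros m; set (s := (r ^ m)%R).
assert (Hs : (0 < s <= 1)%R).
{ split; [apply pow_lt; lra|]; unfold s; rewrite <- (pow1 m); apply pow_incr; lra. }
(* The modulus of q^(2m) is s^2, weakened to [s], which still tends to 0. *)
assert (Hl : forall c : C, (Cmod c <= L)%R -> (Cmod (c * q ^ (2 * m)) <= L * s)%R).
{ intros c Hc; rewrite Cmod_mult, Cmod_pow; fold r.
  replace (2 * m)%nat with (m + m)%nat by lia; rewrite pow_add; fold s.
  pose proof (Cmod_ge_0 c); apply Rmult_le_compat; nra. }
assert (Ha := Hl a (Rmax_l _ _)); assert (Hb := Hl b (Rmax_r _ _)).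
assert (HLs : (0 <= L * s <= L)%R) by nra.
set (a' := a * q ^ (2 * m)) in *; set (b' := b * q ^ (2 * m)) in *.
(* Since L s <= L, the same [M] works for every [m]. *)
assert (Hclose : geom_close M r (cf_num a' b' q) (cf_den a' b' q))
  by (apply cf_geom_close; lra).
replace (weight M r 0 * ((5 * L ^ 2 + L ^ 4) * B) / (1 - r) * s)%R
  with (weight M r 0 * ((5 * L ^ 2 + L ^ 4) * B * s) / (1 - r))%R
  by (field; lra).
apply (cf_tail_perturb M r HM Hr _ _ Hclose).
- apply Rmult_le_pos; [|lra]; apply Rmult_le_pos; lra.
- intros j _.
  destruct (cf_coeffs_near_0 a' b' (L * s) j Ha Hb) as [D N]; fold r in D, N.
  replace (tail 0 0 j - (cf_den a' b' q j * tail 0 0 (S j)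
      + cf_num a' b' q (S j) * tail 0 0 (S (S j))))
    with (- ((cf_den a' b' q j - 1) * tail 0 0 (S j)
      + (cf_num a' b' q (S j) - cf_num 0 0 q (S j)) * tail 0 0 (S (S j))))
    by (rewrite (tail_rec 0 0 j), (cf_den_sqr 0 0); ring).
  rewrite Cmod_opp; eapply Rle_trans; [apply Cmod_triangle|]; rewrite !Cmod_mult.
  assert (Hj : (0 <= r ^ j)%R) by (apply pow_le; lra).
  apply Rle_trans with ((L * s) ^ 2 * r ^ j * B
    + (4 * (L * s) ^ 2 + (L * s) ^ 4) * r ^ j * B)%R.
  + apply Rplus_le_compat; apply Rmult_le_compat; auto; apply Cmod_ge_0.
  + replace ((L * s) ^ 2 * r ^ j * B
      + (4 * (L * s) ^ 2 + (L * s) ^ 4) * r ^ j * B)%R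
      with ((5 * L ^ 2 * s ^ 2 + L ^ 4 * s ^ 4) * (B * r ^ j))%R by ring.
    replace ((5 * L ^ 2 + L ^ 4) * B * s * r ^ j)%R
      with ((5 * L ^ 2 * s + L ^ 4 * s) * (B * r ^ j))%R by ring.
    apply Rmult_le_compat_r; [now apply Rmult_le_pos|].
    assert (s ^ 2 <= s)%R by nra.
    assert (s ^ 4 <= s)%R.
    { replace (s ^ 4)%R with (s ^ 2 * s ^ 2)%R by ring; nra. }
    apply Rplus_le_compat; apply Rmult_le_compat_l; lra.
- apply tail_lim.
Qed.

(** At zero parameters X_{2j+1} = X_{2j+2} = (1 + q^(2j+2)) X_{2j+3} with nonzero factors. A zero at
    index 1 would spread to all odd indices, against the limit 1. *)
Lemma tail_0_neq_0 : tail 0 0 1 <> 0.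
Proof.
intros E.
assert (H : forall j, tail 0 0 (S (2 * j)) = 0).
{ assert (Hodd : forall j, tail 0 0 (S (2 * j)) = tail 0 0 (S (S (2 * j)))).
  { intros j; rewrite (tail_rec 0 0 (S (2 * j))), cf_num_2j2, cf_den_sqr; ring. }
  induction j as [|j IH]; [exact E|].
  assert (H : (1 + q ^ (2 * S j)) * tail 0 0 (S (2 * S j)) = 0).
  { transitivity (tail 0 0 (S (2 * j))); [rewrite (Hodd j)|exact IH].
    replace (S (S (2 * j))) with (2 * S j)%nat by lia.
    rewrite (tail_rec 0 0 (2 * S j)), cf_num_2j1, cf_den_sqr, <- (Hodd (S j)); ring. }
  destruct (Ceq_dec (tail 0 0 (S (2 * S j))) 0) as [Z|Z]; [assumption|].
  exfalso; revert H; apply Cmult_neq_0; [|exact Z].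
  intros Z'.
  assert (Hlt : (Cmod (q ^ (2 * S j)) < 1)%R).
  { pose proof Cmod_q_bounds; rewrite Cmod_pow.
    apply pow_lt_1_compat; [lra|lia]. }
  replace (q ^ (2 * S j)) with ((1 + q ^ (2 * S j)) + - (1)) in Hlt by ring.
  rewrite Z', Cplus_0_l, Cmod_opp, Cmod_1 in Hlt; lra. }
destruct (Ccvg_eventually_neq0 _ _ C1_nz (tail_lim 0 0)) as [N HN].
apply (HN (S (2 * N))); [lia|apply H].
Qed.

(** * Identification of the infinite products *)

Lemma qpoch_of_cvg (x p l : C) : Ccvg (qpoch_fin x p) l -> qpoch x p = l.
Proof.
intros H.
apply (@iota_filterlim_locally C_AbsRing C_CompleteNormedModule nat eventually _
  (qpoch_fin x p) l).
now apply Ccvg_filterlim.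
Qed.

Lemma qpoch_fin_0 (p : C) (m : nat) : qpoch_fin 0 p m = 1.
Proof.
induction m as [|m IH]; [reflexivity|]; cbn [qpoch_fin]; rewrite IH; ring.
Qed.

(* Convergence of the product comes for free from [tail_1_iter] at [b = 0]. *)
Lemma qpoch_fin_cvg (a : C) :
  Ccvg (qpoch_fin (a ^ 2 * q ^ 3) (q ^ 4)) (qpoch (a ^ 2 * q ^ 3) (q ^ 4)).
Proof.
assert (H : Ccvg (qpoch_fin (a ^ 2 * q ^ 3) (q ^ 4)) (tail a 0 1 / tail 0 0 1)).
{ pose proof (tail_continuous_0 a 0) as Hc.
  destruct (Ccvg_eventually_neq0 _ _ tail_0_neq_0 Hc) as [N HN].
  apply Ccvg_ext_loc with
    (fun m => tail a 0 1 / tail (a * q ^ (2 * m)) (0 * q ^ (2 * m)) 1).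
  - exists N; intros n Hn; rewrite (tail_1_iter a 0 n).
    replace (0 ^ 2 * q ^ 3) with (RtoC 0) by ring; rewrite qpoch_fin_0.
    field; now apply HN.
  - apply Ccvg_div; [apply tail_0_neq_0|apply Ccvg_const|exact Hc]. }
now rewrite (qpoch_of_cvg _ _ _ H).
Qed.

Lemma tail_1_qpoch (a b : C) :
  tail a b 1 = qpoch2 (a ^ 2 * q ^ 3) (b ^ 2 * q ^ 3) (q ^ 4) * tail 0 0 1.
Proof.
apply (Ccvg_unique (fun _ => tail a b 1)); [apply Ccvg_const|].
apply Ccvg_ext with
  (fun m => qpoch_fin (a ^ 2 * q ^ 3) (q ^ 4) m
            * qpoch_fin (b ^ 2 * q ^ 3) (q ^ 4) m
            * tail (a * q ^ (2 * m)) (b * q ^ (2 * m)) 1).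
- intros m; symmetry; apply tail_1_iter.
- apply Ccvg_mult; [|apply tail_continuous_0].
  apply Ccvg_mult; apply qpoch_fin_cvg.
Qed.

(** By [tail_1] and [tail_2], a_1 X_2(a,b) is X_1(a/q,b/q), so the numerator is the product formula
    at parameters divided by [q]. *)
Lemma cf_num_1_tail_2 (a b : C) :
  cf_num a b q 1 * tail a b 2
  = qpoch2 (a ^ 2 * q) (b ^ 2 * q) (q ^ 4) * tail 0 0 1.
Proof.
replace (a ^ 2 * q) with ((a / q) ^ 2 * q ^ 3) by (field; assumption).
replace (b ^ 2 * q) with ((b / q) ^ 2 * q ^ 3) by (field; assumption).
rewrite <- tail_1_qpoch, tail_1, tail_2.
replace (a / q * q ^ 2) with (a * q) by (field; assumption).
replace (b / q * q ^ 2) with (b * q) by (field; assumption).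
rewrite (cf_num_2j1 a b 0 : cf_num a b q 1 = _).
change (q ^ (2 * 0)) with (RtoC 1); field; assumption.
Qed.
End Tails.

(** * The value of the continued fraction *)

Theorem corollary3p3 :
  forall a b q : C,
    a <> 0 ->
    (Cmod q < 1)%R ->
    (Cmod (q * b / a) < 1)%R ->
    qpoch2 (a ^ 2 * q ^ 3) (b ^ 2 * q ^ 3) (q ^ 4) <> 0 ->
    (forall k : nat, (1 <= k)%nat -> cf_num a b q k <> 0) ->
    is_cf_value (cf_num a b q) (cf_den a b q)
      (Cfin (qpoch2 (a ^ 2 * q) (b ^ 2 * q) (q ^ 4)
             / qpoch2 (a ^ 2 * q ^ 3) (b ^ 2 * q ^ 3) (q ^ 4))).
Proof.
intros a b q _ Hq _ Hden Hnum.
(* The nonzero numerator a_2 contains the factor q^2. *)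
assert (Hq0 : q <> 0).
{ intros E; apply (Hnum 2%nat); [lia|].
  rewrite (cf_num_2j2 q a b 0 : cf_num a b q 2 = _), E; simpl; ring. }
pose proof (tail_0_neq_0 q Hq0 Hq) as HG.
assert (HX : tail q a b 1 <> 0).
{ rewrite tail_1_qpoch by assumption; now apply Cmult_neq_0. }
pose proof (tail_cvg q Hq0 Hq a b) as Hcv.
assert (Hden_cvg : Ccvg (fun n => contin (cf_num a b q) (cf_den a b q) (S n) 1)
                     (tail q a b 1)).
{ apply Ccvg_ext with
    (fun n => contin (cf_num a b q) (cf_den a b q) (n + 1)%nat 1).
  - intros n; now rewrite Nat.add_1_r.
  - exact (Ccvg_shift _ _ 1 (Hcv 1%nat)). }
assert (Hlim : Ccvg
  (fun n => cf_num a b q 1 * contin (cf_num a b q) (cf_den a b q) n 2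
            / contin (cf_num a b q) (cf_den a b q) (S n) 1)
  (qpoch2 (a ^ 2 * q) (b ^ 2 * q) (q ^ 4)
   / qpoch2 (a ^ 2 * q ^ 3) (b ^ 2 * q ^ 3) (q ^ 4))).
{ replace (qpoch2 (a ^ 2 * q) (b ^ 2 * q) (q ^ 4)
           / qpoch2 (a ^ 2 * q ^ 3) (b ^ 2 * q ^ 3) (q ^ 4))
    with (cf_num a b q 1 * tail q a b 2 / tail q a b 1).
  - apply Ccvg_div; [exact HX| |exact Hden_cvg].
    apply Ccvg_mult; [apply Ccvg_const|apply Hcv].
  - rewrite cf_num_1_tail_2, (tail_1_qpoch q Hq0 Hq a b) by assumption; field; now split. }
intros P HP.
destruct (Ccvg_filterlim _ _ Hlim _ HP) as [N1 HN1].
destruct (Ccvg_eventually_neq0 _ _ HX Hden_cvg) as [N2 HN2].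
exists (N1 + N2)%nat; intros n Hn; unfold cf_approximant.
destruct (cf_from_contin (cf_num a b q) (cf_den a b q) n 1)
  as [[_ E]|[Z _]]; auto.
- rewrite E; apply HN1; lia.
(* An infinite approximant means a vanishing continuant, excluded for large [n] because the
   continuants tend to the nonzero [tail q a b 1]. *)
- exfalso; apply (HN2 n); [lia|exact Z].
Qed.
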